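(* Let $\Gamma$ be a finite graph with an embedding $\sigma$ into a connected surface $\Sigma$ and a vertex coloring $\mathfrak{c}$, and let $c\neq c'$ be two colors used by $\mathfrak{c}$. Then $$\beta_{\Gamma}(x)=x\,\beta_{\Gamma_{c=c'}}(x)+\beta_{\Gamma_{\neq c}}(x)+\beta_{\Gamma_{\neq c'}}(x)-(1+x)\,\beta_{\Gamma_{\neq c,c'}}(x),$$ where all polynomials are colored island boundary polynomials (with the embedding $\sigma$ or its restrictions).
   Context: Graphs are finite and may have multiple edges and self-loops; a graph is viewed as a topological space. A subgraph is induced if it contains every edge of the ambient graph whose endpoints lie in its vertex set. For a connected subgraph $\Gamma'$, $f_\sigma(\Gamma')$ is the number of path components of $\Sigma\setminus\sigma(\Gamma')$; for a subgraph with components $\Gamma'_1,\dots,\Gamma'_k$, $f_\sigma(\Gamma')=\sum_j f_\sigma(\Gamma'_j)$, and $f_\sigma(\emptyset)=0$. A vertex coloring is any map $\mathfrak{c}:V(\Gamma)\to\mathcal{C}$ (not necessarily proper). For a colored embedded graph $(G,\sigma,\mathfrak{c})$ using $m$ colors and $1\le i\le m$, let $\mathscr{F}_i(G,\mathfrak{c})$ be the set of induced subgraphs of $G$ whose vertex set is exactly the union of the color classes of some $i$ distinct colors, put $\mathscr{D}_i(G,\sigma,\mathfrak{c})=\sum_{G'\in\mathscr{F}_i(G,\mathfrak{c})} f_\sigma(G')$, and define the colored island boundary polynomial $\beta_{(G,\sigma,\mathfrak{c})}(x)=\sum_{i=1}^{m}\mathscr{D}_i(G,\sigma,\mathfrak{c})x^{i-1}$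 (the polynomial of the empty graph is $0$). $\Gamma_{c=c'}$ is the same embedded graph with every vertex of color $c$ recolored $c'$. $\Gamma_{\neq c}$ (resp. $\Gamma_{\neq c'}$, $\Gamma_{\neq c,c'}$) is the induced subgraph on the vertices not colored $c$ (resp. not colored $c'$, not colored $c$ or $c'$), with restricted embedding and coloring. *)

(* Defs.v *)
From HB Require Import structures.
From mathcomp Require Import all_boot all_order all_algebra.
From mathcomp Require Import finmap.
From mathcomp Require Import all_classical all_reals all_analysis.

Set Implicit Arguments.
Unset Strict Implicit.
Unset Printing Implicit Defensive.

Import Order.TTheory GRing.Theory Num.Theory.
Import numFieldTopology.Exports.

Local Open Scope classical_set_scope.
Local Open Scope ring_scope.

                                                                                 
                                                                                 
Record multigraph := Multigraph {
  vertex : finType;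
  edge : finType;
  source : edge -> vertex;
  target : edge -> vertex }.

Section Realization.
Variables (R : realType) (G : multigraph).

                                                                                 
                                                                                 
Definition realization : Type :=
  (vertex G + edge G * {t : R | 0 < t < 1})%type.

HB.instance Definition _ := Choice.on realization.

Definition edge_map (e : edge G) (t : set_type `[0 : R, 1]) : realization :=
  if insub (val t) is Some s then inr (e, s)
  else inl (if val t == 0 then source e else target e).

                                                                                 
                                                                                 
Definition realization_open (U : set realization) :=
  forall e, open (edge_map e @^-1` U).

Lemma realization_openT : realization_open setT.
Proof. by move=> e; rewrite preimage_setT; exact: openT. Qed.

Lemma realization_openI : setI_closed realization_open.
Proof. by move=> A B oA oB e; rewrite preimage_setI; exact: openI. Qed.

Lemma realization_open_bigU (I : Type) (f : I -> set realization) :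
  (forall i, realization_open (f i)) -> realization_open (\bigcup_i f i).
Proof.
by move=> of_ e; rewrite preimage_bigcup; apply: bigcup_open => i _; exact: of_.
Qed.

HB.instance Definition _ := isOpenTopological.Build realization
  realization_openT realization_openI realization_open_bigU.

End Realization.

Section Subgraph.
Variable G : multigraph.

Definition is_subgraph (H : {set vertex G} * {set edge G}) : bool :=
  [forall e in H.2, (source e \in H.1) && (target e \in H.1)].

Definition subgraph : Type :=
  {H : {set vertex G} * {set edge G} | is_subgraph H}.

HB.instance Definition _ := Finite.on subgraph.

Definition vset (H : subgraph) : {set vertex G} := (val H).1.
Definition eset (H : subgraph) : {set edge G} := (val H).2.

Definition is_induced (H : subgraph) : bool :=
  [forall e, (source e \in vset H) && (target e \in vset H) ==> (e \in eset H)].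

Lemma induced_subproof (W : {set vertex G}) :
  is_subgraph (W, [set e | (source e \in W) && (target e \in W)])%SET.
Proof. by apply/forall_inP => e; rewrite inE. Qed.

Definition induced (W : {set vertex G}) : subgraph :=
  exist is_subgraph _ (induced_subproof W).

Definition subgraph_le (K H : subgraph) : bool :=
  (vset K \subset vset H) && (eset K \subset eset H).

Definition adjacent (H : subgraph) : rel (vertex G) := fun u v =>
  [exists e in eset H, ((source e == u) && (target e == v))
                    || ((source e == v) && (target e == u))].

Definition connected_subgraph (H : subgraph) : bool :=
  [exists v, v \in vset H] &&
  [forall u in vset H, forall v in vset H, connect (adjacent H) u v].

                                            
Definition components (H : subgraph) : {set subgraph} :=
  [set K | [&& subgraph_le K H, connected_subgraph K &
    [forall L, [&& subgraph_le L H, connected_subgraph L & subgraph_le K L]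
               ==> (L == K)]]]%SET.

Lemma source_in (H : subgraph) (e : {e | e \in eset H}) :
  source (val e) \in vset H.
Proof. by have /forall_inP/(_ _ (valP e))/andP[] := valP H. Qed.

Lemma target_in (H : subgraph) (e : {e | e \in eset H}) :
  target (val e) \in vset H.
Proof. by have /forall_inP/(_ _ (valP e))/andP[] := valP H. Qed.

Definition graph_of (H : subgraph) : multigraph :=
  @Multigraph {v | v \in vset H} {e | e \in eset H}
    (fun e => exist (fun v => v \in vset H) _ (source_in e)) (fun e => exist (fun v => v \in vset H) _ (target_in e)).

Definition realization_incl (R : realType) (H : subgraph)
    (x : realization R (graph_of H)) : realization R G :=
  match x with
  | inl v => inl (val v)
  | inr (e, t) => inr (val e, t)
  end.

End Subgraph.

Section Topology.

                                                                      
Definition connected_surface (R : realType) (S : topologicalType) : Prop :=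
  [/\ hausdorff_space S, @second_countable S, connected [set: S] &
    forall x : S, exists (U : set S) (phi : S -> R * R),
      [/\ open U /\ U x, {in U &, injective phi}, {within U, continuous phi} &
        forall W : set S, open W -> W `<=` U -> open (phi @` W)]].

                                  
Definition embedding (X Y : topologicalType) (f : X -> Y) : Prop :=
  [/\ injective f, continuous f &
    forall U : set X, open U -> exists2 V, open V & f @` U = V `&` range f].

Definition path_joined (R : realType) (S : topologicalType) (A : set S)
    (x y : S) : Prop :=
  exists gamma : R -> S,
    [/\ {within `[0, 1], continuous gamma}, gamma 0 = x, gamma 1 = y &
      gamma @` `[0, 1] `<=` A].

Definition path_components (R : realType) (S : topologicalType) (A : set S) :
    set (set S) :=
  [set [set y | path_joined R A x y] | x in A].

End Topology.

Section IslandBoundary.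
Variables (R : realType) (S : topologicalType) (G : multigraph).
Variable sigma : realization R G -> S.

                                                                                 
                                                                                 
Definition num_regions (H : subgraph G) : nat :=
  #|` fset_set (path_components R (~` (sigma @` range (@realization_incl G R H))))|.

Definition island_boundary (H : subgraph G) : nat :=
  (\sum_(K in components H) num_regions K)%N.

Variables (C : choiceType) (col : vertex G -> C).

Definition used_colors : {fset C} := [fset x in codom col]%fset.

Definition color_subgraphs (i : nat) : {set subgraph G} :=
  [set H | is_induced H &&
    `[< exists T : {fset C}, [/\ (T `<=` used_colors)%fset, #|` T| = i &
          vset H = [set v | col v \in T]%SET] >]]%SET.

Definition color_boundary (i : nat) : nat :=
  (\sum_(H in color_subgraphs i) island_boundary H)%N.

Definition island_poly : {poly int} :=
  \sum_(1 <= i < #|` used_colors|.+1) (color_boundary i)%:R *: 'X^(i.-1).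

End IslandBoundary.

Definition recolor (V : Type) (C : eqType) (col : V -> C) (c c' : C) : V -> C :=
  fun v => if col v == c then c' else col v.

Definition restrict_embedding (R : realType) (S : topologicalType)
    (G : multigraph) (sigma : realization R G -> S) (H : subgraph G) :
    realization R (graph_of H) -> S :=
  sigma \o @realization_incl G R H.

Definition restrict_coloring (G : multigraph) (C : Type) (col : vertex G -> C)
    (H : subgraph G) : vertex (graph_of H) -> C :=
  fun v => col (val v).

Definition avoiding (G : multigraph) (C : eqType) (col : vertex G -> C)
    (s : seq C) : subgraph G :=
  induced [set v | col v \notin s]%SET.

Definition restricted_island_poly (R : realType) (S : topologicalType)
    (G : multigraph) (sigma : realization R G -> S) (C : choiceType)
    (col : vertex G -> C) (H : subgraph G) : {poly int} :=
  island_poly (restrict_embedding sigma (H := H)) (restrict_coloring col (H := H)).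

(* Main.v *)
(** Write U for the used colors other than c and c'. Each polynomial is a sum of
    b(T) x^(|T|-1) over all subsets T of its color set, where b(T) is the island
    boundary of the subgraph induced on the colors of T; the empty T may be
    included because b vanishes on it. Deleting color classes changes neither
    b(T) nor |T| for the remaining T, since components and complements are
    computed in the same surface. Recoloring c as c' identifies the sets
    {c'} + T with {c, c'} + T, which loses one factor x. Splitting the subsets
    according to whether they contain c and c' reduces the identity to algebra. *)
Require Import Defs.
From mathcomp Require Import all_boot all_order all_algebra.
From mathcomp Require Import finmap.
From mathcomp Require Import all_classical all_reals all_analysis.
From mathcomp Require Import ring.

Import Order.TTheory GRing.Theory Num.Theory Defs.

Local Open Scope ring_scope.

Section Subgraphs.
Set Implicit Arguments.
Unset Strict Implicit.
Unset Printing Implicit Defensive.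
Variable G : multigraph.

Lemma subgraph_eq (K L : subgraph G) :
  vset K = vset L -> eset K = eset L -> K = L.
Proof.
move=> eqv eqe; apply: val_inj.
by rewrite [val K]surjective_pairing [val L]surjective_pairing; congr pair.
Qed.

Lemma subgraph_le_trans : transitive (@subgraph_le G).
Proof.
move=> L K M /andP[vKL eKL] /andP[vLM eLM].
by apply/andP; split; [apply: fintype.subset_trans vLM | apply: fintype.subset_trans eLM].
Qed.

Lemma is_induced_induced (W : {set vertex G}) :
  is_induced (induced W).
Proof. by apply/forallP => e; apply/implyP; rewrite inE. Qed.

End Subgraphs.

(** * Subgraphs of a subgraph, transported to the ambient graph *)

Section Lift.
Set Implicit Arguments.
Unset Strict Implicit.
Unset Printing Implicit Defensive.
Variables (G : multigraph) (H : subgraph G).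
Implicit Types K L : subgraph (graph_of H).

Lemma lift_subproof K : is_subgraph (val @: vset K, val @: eset K)%SET.
Proof.
apply/forall_inP => /= _ /imsetP[e eK ->].
have /forall_inP/(_ _ eK)/andP[sK tK] := valP K.
by apply/andP; split; [apply: (imset_f val sK) | apply: (imset_f val tK)].
Qed.

Definition lift_subgraph K : subgraph G :=
  exist (@is_subgraph G) (val @: vset K, val @: eset K)%SET (lift_subproof K).

Lemma vset_lift K : vset (lift_subgraph K) = (val @: vset K)%SET.
Proof. by []. Qed.

Lemma eset_lift K : eset (lift_subgraph K) = (val @: eset K)%SET.
Proof. by []. Qed.

Lemma lift_subgraph_le K L :
  subgraph_le (lift_subgraph K) (lift_subgraph L) = subgraph_le K L.
Proof.
suff subE (T : finType) (P : pred T) (A B : {set {x | P x}}) :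
    (val @: A \subset val @: B) = (A \subset B).
  by rewrite /subgraph_le !subE.
apply/idP/idP => [/fintype.subsetP sAB|]; last exact: imsetS.
apply/fintype.subsetP => x xA.
by have := sAB _ (imset_f val xA); rewrite (mem_imset _ _ val_inj).
Qed.

Lemma lift_subgraph_inj : injective lift_subgraph.
Proof.
move=> K L eqKL; apply: subgraph_eq; apply: (imset_inj val_inj).
  by rewrite -!vset_lift eqKL.
by rewrite -!eset_lift eqKL.
Qed.

Lemma lift_subgraph_le_ambient K : subgraph_le (lift_subgraph K) H.
Proof.
by apply/andP; split; apply/fintype.subsetP => _ /imsetP[x _ ->]; exact: (valP x).
Qed.

Lemma imset_preimset_val (T : finType) (P : pred T) (A : {set T}) :
  A \subset P -> (val @: [set x : {x | P x} | val x \in A] = A)%SET.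
Proof.
move=> /fintype.subsetP sAP; apply/setP => y; apply/imsetP/idP.
  by case=> x; rewrite inE => xA ->.
by move=> yA; exists (exist _ y (sAP _ yA)); rewrite ?inE.
Qed.

(** Take preimages under [val]. With injectivity and [lift_subgraph_le_ambient], lifting becomes a
    bijection onto the subgraphs of [G] below [H]. *)
Lemma lift_subgraph_surj (L : subgraph G) :
  subgraph_le L H -> exists K, L = lift_subgraph K.
Proof.
case/andP => svLH seLH.
pose P : {set vertex (graph_of H)} * {set edge (graph_of H)} :=
  ([set v | val v \in vset L], [set e | val e \in eset L])%SET.
have subP : is_subgraph P.
  apply/forall_inP => e; rewrite !inE => eL.
  by have /forall_inP/(_ _ eL) := valP L.
exists (exist _ P subP).
by apply: subgraph_eq; rewrite ?vset_lift ?eset_lift /= imset_preimset_val.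
Qed.

(** Only edges could be lost: an edge of [G] with both ends in [W] has both ends in [H], and so lies
    in [H] because [H] is induced. *)
Lemma lift_induced (W : {set vertex G}) (W' : {set vertex (graph_of H)}) :
  is_induced H -> W \subset vset H ->
  W' = [set v | val v \in W]%SET ->
  lift_subgraph (induced W') = induced W.
Proof.
move=> indH sWH ->; have sWH' := fintype.subsetP sWH.
apply: subgraph_eq; first by rewrite vset_lift imset_preimset_val.
rewrite eset_lift /=; apply/setP => e; apply/imsetP/idP.
  by case=> e'; rewrite !inE /= => eW ->.
rewrite inE => /andP[sW tW].
have /forallP/(_ e)/implyP eH := indH.
have {}eH : e \in eset H by apply: eH; rewrite !sWH'.
by exists (exist (fun e => e \in eset H) e eH); rewrite // !inE /= sW.
Qed.

Lemma adjacent_lift K (u v : vertex (graph_of H)) :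
  adjacent (lift_subgraph K) (val u) (val v) = adjacent K u v.
Proof.
apply/exists_inP/exists_inP.
  by case=> _ /imsetP[e eK ->] adj; exists e.
by case=> e eK adj; exists (val e); [exact: imset_f | exact: adj].
Qed.

(** A path that starts in [H] and uses lifted edges never leaves [H]; this lets the induction in
    [connect_lift] pull paths back. *)
Lemma adjacent_liftP K (u : vertex (graph_of H)) y :
  adjacent (lift_subgraph K) (val u) y -> exists v : vertex (graph_of H), y = val v.
Proof.
case/exists_inP => _ /imsetP[e eK ->] /orP[] /andP[/eqP ? /eqP ?]; subst y.
  by exists (@target (graph_of H) e).
by exists (@source (graph_of H) e).
Qed.

Lemma connect_lift K (u v : vertex (graph_of H)) :
  connect (adjacent (lift_subgraph K)) (val u) (val v) = connect (adjacent K) u v.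
Proof.
apply/idP/idP => /connectP[p].
  elim: p u => [|y p IHp] u /= => [_ /val_inj -> //|].
  case/andP => uy; case: (adjacent_liftP uy) => w yw; subst y.
  move=> pth lst; apply: connect_trans (IHp _ pth lst).
  by apply: connect1; rewrite -adjacent_lift.
elim: p u => [|y p IHp] u /= => [_ -> //|/andP[uy pth] lst].
by apply: connect_trans (IHp _ pth lst); apply: connect1; rewrite adjacent_lift.
Qed.

Lemma connected_lift K :
  connected_subgraph (lift_subgraph K) = connected_subgraph K.
Proof.
congr andb.
  apply/existsP/existsP => [[_ /imsetP[v vK _]]|[v vK]]; first by exists v.
  by exists (val v); exact: imset_f.
apply/forall_inP/forall_inP => [cK u uK | cK _ /imsetP[u uK ->]].
  apply/forall_inP => v vK; rewrite -connect_lift.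
  by have /forall_inP := cK _ (imset_f val uK); apply; exact: imset_f.
apply/forall_inP => _ /imsetP[v vK ->]; rewrite connect_lift.
by have /forall_inP := cK _ uK; apply.
Qed.

(** Maximality is tested only against subgraphs of the lift of [K]. These lie below [H], hence are
    lifts themselves, and lifting preserves and reflects both inclusion and connectedness. *)
Lemma components_lift K :
  components (lift_subgraph K) = (lift_subgraph @: components K)%SET.
Proof.
apply/setP => L; apply/idP/imsetP.
  rewrite inE => /and3P[leLK cL /forallP maxL].
  have [M eqL] : exists M, L = lift_subgraph M.
    by apply: lift_subgraph_surj; exact: subgraph_le_trans leLK (lift_subgraph_le_ambient K).
  subst L; exists M => //; rewrite inE.
  rewrite -lift_subgraph_le leLK -connected_lift cL /=.
  apply/forallP => N; have := maxL (lift_subgraph N).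
  by rewrite !lift_subgraph_le connected_lift (inj_eq lift_subgraph_inj).
case=> M; rewrite inE => /and3P[leMK cM /forallP maxM] ->.
rewrite inE lift_subgraph_le leMK connected_lift cM /=.
apply/forallP => N; apply/implyP => /and3P[leNK cN leMN].
have [N' eqN] : exists N', N = lift_subgraph N'.
  by apply: lift_subgraph_surj; exact: subgraph_le_trans leNK (lift_subgraph_le_ambient K).
subst N; rewrite (inj_eq lift_subgraph_inj).
move: (maxM N') leNK cN leMN.
by rewrite !lift_subgraph_le connected_lift => /implyP maxN' *; apply: maxN'; apply/and3P.
Qed.

End Lift.

(** * Island boundaries under restriction of the embedding *)

Section Boundary.
Set Implicit Arguments.
Unset Strict Implicit.
Unset Printing Implicit Defensive.
Local Open Scope classical_set_scope.
Variables (R : realType) (S : topologicalType) (G : multigraph).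

Lemma range_realization_incl (G' : multigraph) (K : subgraph G') :
  range (@realization_incl G' R K) =
  [set x | match x with inl v => v \in vset K | inr (e, _) => e \in eset K end].
Proof.
apply/seteqP; split => [_ [[v|[e t]] _ <-]|[v vK|[e t] eK]] /=.
- exact: (valP v).
- exact: (valP e).
- by exists (inl (exist (fun v => v \in vset K) v vK)).
- by exists (inr (exist (fun e => e \in eset K) e eK, t)).
Qed.

Lemma range_realization_incl_lift (H : subgraph G) (K : subgraph (graph_of H)) :
  range (@realization_incl G R (lift_subgraph K)) =
  @realization_incl G R H @` range (@realization_incl _ R K).
Proof.
rewrite !range_realization_incl; apply/seteqP; split.
  case=> [_ /imsetP[v vK ->]|[_ t] /imsetP[e eK ->]].
    by exists (inl v).
  by exists (inr (e, t)).
by move=> _ [[v|[e t]] xK <-] /=; rewrite ?vset_lift ?eset_lift; exact: imset_f.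
Qed.

(** A component and its lift have the same image in [S], hence the same complement, so the two sums
    over components agree term by term. *)
Lemma island_boundary_restrict (sigma : realization R G -> S) (H : subgraph G)
    (K : subgraph (graph_of H)) :
  island_boundary (restrict_embedding sigma (H := H)) K =
  island_boundary sigma (lift_subgraph K).
Proof.
rewrite /island_boundary components_lift big_imset /=; last first.
  by move=> L M _ _; exact: lift_subgraph_inj.
apply: eq_bigr => L _; rewrite /num_regions range_realization_incl_lift.
by rewrite /restrict_embedding -image_comp.
Qed.

(** A component must contain a vertex, so here the sum is empty. *)
Lemma island_boundary0 (sigma : realization R G -> S) :
  island_boundary sigma (induced finset.set0) = 0%N.
Proof.
rewrite /island_boundary big1 // => K; rewrite inE.
case/and3P => /andP[/fintype.subsetP sK _] /andP[/existsP[v vK] _] _.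
by have := sK _ vK; rewrite inE.
Qed.

End Boundary.

(** * The polynomial as a sum over sets of colors *)

Section Polynomial.
Set Implicit Arguments.
Unset Strict Implicit.
Unset Printing Implicit Defensive.
Local Open Scope fset_scope.
Local Open Scope ring_scope.

Lemma big_fpowerset_fset1U (V : nmodType) (C : choiceType) (c : C) (U : {fset C})
    (F : {fset C} -> V) : c \notin U ->
  \sum_(T <- fpowerset (c |` U)) F T =
  \sum_(T <- fpowerset U) F T + \sum_(T <- fpowerset U) F (c |` T).
Proof.
move=> cU.
have cT (T : {fset C}) : T `<=` U -> c \notin T.
  by move=> /fsubsetP sTU; apply: contra cU; exact: sTU.
rewrite -(big_map (fun T => c |` T) xpredT F) -big_cat.
apply: perm_big; apply: uniq_perm.
- exact: fset_uniq.
- rewrite cat_uniq fset_uniq map_inj_in_uniq ?fset_uniq ?andbT /=.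
    apply/hasPn => _ /mapP[T _ ->]; rewrite fpowersetE.
    by apply/negP => /cT; rewrite fset1U1.
  move=> A B; rewrite !fpowersetE => /cT cA /cT cB eqAB.
  by rewrite -(fsetU1K cA) eqAB fsetU1K.
move=> T; rewrite mem_cat !fpowersetE; apply/idP/orP.
  move=> sT; have [cinT|cninT] := boolP (c \in T).
    right; apply/mapP; exists (T `\ c); last by rewrite fsetD1K.
    by rewrite fpowersetE fsubDset.
  left; apply/fsubsetP => x xT; have := fsubsetP sT _ xT.
  by rewrite !inE => /orP[/eqP xc|//]; rewrite -xc xT in cninT.
case=> [sT|/mapP[T']]; first by apply: fsubset_trans sT (fsubsetU1 _ _).
by rewrite fpowersetE => sT ->; exact: fsetUS.
Qed.

Variables (R : realType) (S : topologicalType).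

(** At [T = fset0] the truncated predecessor gives exponent 0, which is harmless since the
    coefficient vanishes. *)
Definition color_weight (G : multigraph) (sigma : realization R G -> S)
    (C : choiceType) (col : vertex G -> C) (T : {fset C}) : {poly int} :=
  (island_boundary sigma (induced [set v | col v \in T]%SET))%:R *:
    'X^(#|` T|.-1).

Lemma color_weight0 (G : multigraph) (sigma : realization R G -> S)
    (C : choiceType) (col : vertex G -> C) :
  color_weight sigma col fset0 = 0.
Proof.
rewrite /color_weight [X in induced X](_ : _ = finset.set0).
  by rewrite island_boundary0 scale0r.
by apply/setP => v; rewrite !inE.
Qed.

(** An induced subgraph is determined by its vertex set, and a set of used colors is recovered from
    the vertices it colors, so color sets of size [i] index [color_subgraphs] without repetition. *)
Lemma color_boundaryE (G : multigraph) (sigma : realization R G -> S)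
    (C : choiceType) (col : vertex G -> C) (i : nat) :
  color_boundary sigma col i =
  (\sum_(T <- fpowerset (used_colors col) | #|` T| == i)
    island_boundary sigma (induced [set v | col v \in T]%SET))%N.
Proof.
rewrite /color_boundary -[RHS]big_filter -(big_map (fun T : {fset C} =>
  induced [set v | col v \in T]%SET) xpredT (island_boundary sigma)) -[LHS]big_enum.
apply: perm_big; apply: uniq_perm.
- exact: enum_uniq.
- rewrite map_inj_in_uniq ?filter_uniq ?fset_uniq // => A B.
  rewrite !mem_filter !fpowersetE => /andP[_ sA] /andP[_ sB].
  move/(congr1 (@vset G))/setP => eqAB.
  (* A used color is [col v] for some [v]; comparing the two vertex sets at [v] decides
     membership. *)
  have memE x : x \in used_colors col -> (x \in A) = (x \in B).
    by rewrite inE => /codomP[v ->]; have := eqAB v; rewrite !inE.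
  apply/fsetP => x; apply/idP/idP => xX.
    by rewrite -memE //; exact: (fsubsetP sA).
  by rewrite memE //; exact: (fsubsetP sB).
move=> H; rewrite mem_enum inE; apply/andP/mapP.
  case=> indH /asboolP[T [sT cT eqT]]; exists T.
    by rewrite mem_filter cT eqxx fpowersetE.
  apply: subgraph_eq => //; apply/setP => e; rewrite inE -eqT.
  apply/idP/idP => [eH|]; first by have /forall_inP/(_ _ eH) := valP H.
  by have /forallP/(_ e)/implyP := indH.
case=> T; rewrite mem_filter fpowersetE => /andP[/eqP cT sT] ->.
by split; [exact: is_induced_induced | apply/asboolP; exists T].
Qed.

(** After exchanging the sums, each nonempty [T] contributes only at [i = #|T|]. The empty set is
    never met on the left, where [i] starts at 1, and has weight 0 on the right. *)
Lemma island_polyE (G : multigraph) (sigma : realization R G -> S)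
    (C : choiceType) (col : vertex G -> C) :
  island_poly sigma col =
  \sum_(T <- fpowerset (used_colors col)) color_weight sigma col T.
Proof.
rewrite /island_poly.
under eq_bigr => i _ do
  rewrite color_boundaryE natr_sum scaler_suml big_mkcond.
rewrite exchange_big /=; apply: eq_big_seq => T; rewrite fpowersetE => sT.
have [->|T0] := eqVneq T fset0.
  rewrite color_weight0 big_nat big1 // => i /andP[i0 _].
  by rewrite cardfs0 ltn_eqF.
rewrite (bigD1_seq #|` T|) ?iota_uniq //=; last first.
  by rewrite mem_index_iota ltnS cardfs_gt0 T0 fsubset_leq_card.
by rewrite eqxx big1 ?addr0 // => i; rewrite eq_sym => /negPf ->.
Qed.

(** Whole color classes are deleted, so a color set within [U] induces the same subgraph in [G] as
    in the smaller graph. Leaving [U] free lets it be given in the form wanted for splitting. *)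
Lemma restricted_island_polyE (G : multigraph) (sigma : realization R G -> S)
    (C : choiceType) (col : vertex G -> C) (s : seq C) (U : {fset C}) :
  (forall x, (x \in U) = (x \in used_colors col) && (x \notin s)) ->
  restricted_island_poly sigma col (avoiding col s) =
  \sum_(T <- fpowerset U) color_weight sigma col T.
Proof.
move=> UE; rewrite /restricted_island_poly island_polyE.
have -> : used_colors (restrict_coloring col (H := avoiding col s)) = U.
  apply/fsetP => x; rewrite UE !inE; apply/codomP/andP.
    case=> v ->; split; first exact: codom_f.
    by have := valP v; rewrite inE.
  case=> /codomP[v ->] vs.
  have vH : v \in vset (avoiding col s) by rewrite inE.
  by exists (exist (fun v => v \in vset (avoiding col s)) v vH).
apply: eq_big_seq => T; rewrite fpowersetE => /fsubsetP sT.
rewrite /color_weight island_boundary_restrict; congr (_%:R *: _).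
congr island_boundary; apply: lift_induced.
- exact: is_induced_induced.
- by apply/fintype.subsetP => v; rewrite !inE => /sT; rewrite UE => /andP[].
- by apply/setP => v; rewrite !inE.
Qed.

End Polynomial.

(** * Splitting color sets by membership of [c] and [c'] *)

Theorem theorem4p4 (R : realType) (S : topologicalType)
    (hS : connected_surface R S) (G : multigraph)
    (sigma : realization R G -> S) (hsigma : embedding sigma)
    (C : choiceType) (col : vertex G -> C) (c c' : C)
    (hc : c \in used_colors col) (hc' : c' \in used_colors col)
    (hcc' : c != c') :
  island_poly sigma col =
    'X * island_poly sigma (recolor col c c')
    + restricted_island_poly sigma col (avoiding col [:: c])
    + restricted_island_poly sigma col (avoiding col [:: c'])
    - (1 + 'X) * restricted_island_poly sigma col (avoiding col [:: c; c']).
Proof.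
pose U := (used_colors col `\ c `\ c')%fset.
have UE x : (x \in U) = [&& x != c', x != c & x \in used_colors col].
  by rewrite !in_fsetD1.
have c'U : c' \notin U by rewrite UE eqxx.
have cU : c \notin U by rewrite UE eqxx andbF.
have c'cU : c' \notin (c |` U)%fset.
  by rewrite in_fset1U negb_or eq_sym hcc'.
have usedE : used_colors col = (c' |` (c |` U))%fset.
  apply/fsetP => x; rewrite !in_fset1U UE.
  by case: eqVneq => [->|_] //=; case: eqVneq => [->|].
have recE : used_colors (recolor col c c') = (c' |` U)%fset.
  apply/fsetP => x; rewrite in_fset1U UE in_fset.
  apply/codomP/idP => [[v ->]|].
    rewrite /recolor; case: (eqVneq (col v) c) => [_|vc]; first by rewrite eqxx.
    by rewrite in_fset codom_f vc !andbT orbN.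
  (* Any vertex originally colored [x] is a witness, since recoloring fixes every color other than
     [c]. *)
  case: (eqVneq x c') => [-> _|xc' /= /andP[xc]].
    have := hc'; rewrite in_fset => /codomP[v ev]; exists v.
    by rewrite /recolor -ev if_same.
  rewrite in_fset => /codomP[v ev]; exists v.
  by rewrite /recolor -ev (negPf xc).
rewrite (@restricted_island_polyE _ _ _ _ _ _ [:: c] (c' |` U)%fset); last first.
  move=> x; rewrite in_fset1U UE in_cons in_nil orbF.
  by case: eqVneq => [->|_] /=; rewrite ?hc' 1?eq_sym ?hcc' // andbC.
rewrite (@restricted_island_polyE _ _ _ _ _ _ [:: c'] (c |` U)%fset); last first.
  move=> x; rewrite in_fset1U UE in_cons in_nil orbF.
  by case: (eqVneq x c) => [->|_] /=; rewrite ?hc ?hcc' // andbC.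
rewrite (@restricted_island_polyE _ _ _ _ _ _ [:: c; c'] U); last first.
  by move=> x; rewrite UE !in_cons in_nil orbF negb_or andbA andbC (andbC (x != c')).
(* The left side becomes four sums over subsets of [U], with nothing, [c], [c'] or both adjoined. *)
rewrite !island_polyE usedE recE !big_fpowerset_fset1U //.
(* A recolored vertex has a color outside [T] both before and after. *)
have -> : \sum_(T <- fpowerset U) color_weight sigma (recolor col c c') T =
          \sum_(T <- fpowerset U) color_weight sigma col T.
  apply: eq_big_seq => T; rewrite fpowersetE => /fsubsetP sTU.
  rewrite /color_weight; congr ((island_boundary _ (induced _))%:R *: _).
  apply/setP => v; rewrite !inE /recolor; case: (eqVneq (col v) c) => // ->.
  by rewrite (negPf (contra (sTU _) c'U)) (negPf (contra (sTU _) cU)).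
(* The same vertices are selected, but one more color is counted before recoloring: the exponents
   are [#|T| + 1] and [#|T|]. *)
have -> : \sum_(T <- fpowerset U) color_weight sigma col (c' |` (c |` T))%fset =
    'X * \sum_(T <- fpowerset U) color_weight sigma (recolor col c c') (c' |` T)%fset.
  rewrite mulr_sumr; apply: eq_big_seq => T; rewrite fpowersetE => /fsubsetP sTU.
  have cT := contra (sTU _) cU; have c'T := contra (sTU _) c'U.
  have c'cT : c' \notin (c |` T)%fset by rewrite in_fset1U negb_or eq_sym hcc'.
  rewrite /color_weight -scalerAr !cardfsU1 c'cT cT c'T /= -exprS.
  congr ((island_boundary _ (induced _))%:R *: _).
  apply/setP => v; rewrite !inE /recolor.
  by case: (eqVneq (col v) c) => [->|_] //=; rewrite !eqxx orbT.
ring.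
Qed.
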